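(* Let $\beta\Sigma_5\subset\Sigma_6$ be the subgroup generated by the permutations $(03)(14)(25)$, $(01)(24)(35)$, $(05)(14)(23)$, $(01)(25)(34)$ of the coordinate indices $\{0,\dots,5\}$. The union of the two $\beta\Sigma_5$-orbits of $V_{0-1,2-3,4-5}$ and $V_{0+1,2+3,4-5}$ consists of the twenty planes $$V_{0\pm1,2\pm3,4\pm5},\quad V_{0\pm2,1\pm4,3\pm5},\quad V_{0\pm3,1\pm5,2\pm4},\quad V_{0\pm4,1\pm3,2\pm5},\quad V_{0\pm5,1\pm2,3\pm4},$$ all with an odd number of $-$ signs. This is a set of $20$ incident planes (any two of them have non-empty intersection). The span in $\bigwedge^3\mathbb{C}^6$ of the lines $\bigwedge^3\tilde V$, where $\tilde V\subset\mathbb{C}^6$ runs over the $3$-dimensional linear subspaces corresponding to these twenty planes, is a Lagrangian subspace $A$ of $\bigwedge^3\mathbb{C}^6$.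
   Context: We work over $\mathbb{C}$ with homogeneous coordinates $Z_0,\dots,Z_5$ on $\mathbb{P}^5=\mathbb{P}(\mathbb{C}^6)$. For a partition $\{\{i,j\},\{k,l\},\{m,n\}\}$ of $\{0,\dots,5\}$ and three choices of signs, $V_{i\pm j,k\pm l,m\pm n}$ denotes the plane $Z_i\pm Z_j=Z_k\pm Z_l=Z_m\pm Z_n=0$. The group $\Sigma_6$ acts on $\mathbb{P}^5$ by permuting coordinates. The $20$-dimensional space $\bigwedge^3\mathbb{C}^6$ carries the symplectic form $(\omega,\theta)=\omega\wedge\theta\in\bigwedge^6\mathbb{C}^6\cong\mathbb{C}$; Lagrangian means with respect to this form. *)

(* Defs.v *)
From HB Require Import structures.
From mathcomp Require Import all_boot all_order all_algebra all_fingroup all_field.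
From mathcomp Require Import ring.

Set Implicit Arguments.
Unset Strict Implicit.
Unset Printing Implicit Defensive.

Import GRing.Theory.
Local Open Scope ring_scope.

(* The exterior algebra of K^n on its standard basis: x S is the coefficient
   of x on e_S = e_(i_1) ^ ... ^ e_(i_k), where S = {i_1 < ... < i_k}. *)
Definition extalg (K : fieldType) (n : nat) : Type := {ffun {set 'I_n} -> K^o}.

HB.instance Definition _ (K : fieldType) n := Vector.on (extalg K n).

Section ExteriorAlgebra.
Variables (K : fieldType) (n : nat).
Implicit Types (I J S T : {set 'I_n}) (x y z : extalg K n).

Definition inversions I J : nat := (\sum_(i in I) \sum_(j in J) (j < i))%N.

(* e_I ^ e_J is (-1)^(inversions I J) e_(I u J) if I and J are disjoint, and 0
   otherwise. *)
Definition wedge x y : extalg K n :=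
  [ffun S : {set 'I_n} => \sum_(I : {set 'I_n} | I \subset S)
     (-1) ^+ inversions I (S :\: I) * (x I * y (S :\: I))].

Definition extone : extalg K n := [ffun S : {set 'I_n} => (S == set0)%:R].

Lemma inversionsUr I J S : [disjoint J & S] ->
  inversions I (J :|: S) = (inversions I J + inversions I S)%N.
Proof.
move=> dJS; rewrite /inversions -big_split; apply: eq_bigr => i _ /=.
by rewrite -bigU //; apply: eq_bigl => j; rewrite !inE.
Qed.

Lemma inversionsUl I J S : [disjoint I & J] ->
  inversions (I :|: J) S = (inversions I S + inversions J S)%N.
Proof.
by move=> dIJ; rewrite /inversions -bigU //; apply: eq_bigl => j; rewrite !inE.
Qed.

Lemma wedgeA : associative wedge.
Proof.
move=> x y z; apply/ffunP => S; rewrite !ffunE.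
under eq_bigr do rewrite ffunE big_distrr big_distrr /=.
under [RHS]eq_bigr do rewrite ffunE big_distrl big_distrr /=.
rewrite [RHS](exchange_big_dep (fun I => I \subset S)) /=; last first.
  by move=> T I sTS sIT; apply: subset_trans sIT sTS.
apply: eq_bigr => I sIS.
rewrite [RHS](reindex_onto (fun J => I :|: J) (fun T => T :\: I)) /=; last first.
  by move=> T /andP[_ sIT]; rewrite setDE setUIr setUCr setIT; apply/setUidPr.
apply: eq_big => [J | J sJ].
  rewrite subsetUl andbT subUset sIS /= subsetD.
  congr (_ && _); rewrite setDUl setDv set0U.
  by rewrite disjoint_sym setDE; apply/idP/eqP => [d|<-];
    [apply/setIidPl; rewrite -disjoints_subset disjoint_sym
    | rewrite disjoint_sym disjoints_subset subsetIr].
have /andP[sJS dJI] : (J \subset S) && [disjoint J & I] by rewrite -subsetD.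
have dIJ : [disjoint I & J] by rewrite disjoint_sym.
have eJ : (I :|: J) :\: I = J.
  by rewrite setDUl setDv set0U; apply/setDidPl.
rewrite eJ; have -> : S :\: (I :|: J) = (S :\: I) :\: J by rewrite setDDl.
have {1}-> : S :\: I = J :|: ((S :\: I) :\: J).
  by rewrite (setDE _ J) setUIr setUCr setIT; apply/esym/setUidPr.
rewrite inversionsUr; last first.
  by rewrite disjoint_sym disjoints_subset (setDE _ J) subsetIr.
rewrite inversionsUl // !exprD.
by rewrite -[LHS]/(_ : K) -[RHS]/(_ : K); ring.
Qed.

Lemma wedge1x : left_id extone wedge.
Proof.
move=> x; apply/ffunP => S; rewrite ffunE (bigD1 set0) ?sub0set //= big1.
  by rewrite ffunE eqxx setD0 /inversions big_set0 expr0 addr0 !mul1r.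
by move=> I /andP[_ /negPf I0]; rewrite ffunE I0 mul0r mulr0.
Qed.

Lemma wedgex1 : right_id extone wedge.
Proof.
move=> x; apply/ffunP => S; rewrite ffunE (bigD1 S) //= big1.
  rewrite ffunE setDv eqxx /inversions big1 => [|i _]; last by rewrite big_set0.
  by rewrite expr0 addr0 mulr1 mul1r.
move=> I /andP[sIS nIS]; rewrite ffunE setD_eq0.
by rewrite (_ : S \subset I = false) ?mulr0 //; apply: contraNF nIS => sSI;
  rewrite eqEsubset sIS.
Qed.

Lemma wedgeDl : left_distributive wedge +%R.
Proof.
move=> x y z; apply/ffunP => S; rewrite !ffunE -big_split.
by apply: eq_bigr => I _; rewrite !ffunE mulrDl mulrDr.
Qed.

Lemma wedgeDr : right_distributive wedge +%R.
Proof.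
move=> x y z; apply/ffunP => S; rewrite !ffunE -big_split.
by apply: eq_bigr => I _; rewrite !ffunE !mulrDr.
Qed.

Lemma extone_neq0 : extone != 0.
Proof.
by apply/eqP => /ffunP/(_ set0)/eqP; rewrite !ffunE eqxx oner_eq0.
Qed.

Lemma wedgeZl (a : K) x y : a *: wedge x y = wedge (a *: x) y.
Proof.
apply/ffunP => S; rewrite !ffunE scaler_sumr.
apply: eq_bigr => I _; rewrite ffunE -[a *: x I]/(a * x I) -[LHS]/(a * _).
by rewrite -mulrA mulrCA.
Qed.

Lemma wedgeZr (a : K) x y : a *: wedge x y = wedge x (a *: y).
Proof.
apply/ffunP => S; rewrite !ffunE scaler_sumr.
apply: eq_bigr => I _; rewrite ffunE -[a *: y _]/(a * y _) -[LHS]/(a * _).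
by rewrite (mulrCA (x I) a) [RHS]mulrCA.
Qed.
End ExteriorAlgebra.

HB.instance Definition _ (K : fieldType) n :=
  GRing.Zmodule_isNzRing.Build (extalg K n) (@wedgeA K n) (@wedge1x K n)
    (@wedgex1 K n) (@wedgeDl K n) (@wedgeDr K n) (@extone_neq0 K n).
HB.instance Definition _ (K : fieldType) n :=
  GRing.Lmodule_isLalgebra.Build K (extalg K n) (@wedgeZl K n).
HB.instance Definition _ (K : fieldType) n :=
  GRing.Lalgebra_isAlgebra.Build K (extalg K n) (@wedgeZr K n).
HB.instance Definition _ (K : fieldType) n :=
  Algebra_isFalgebra.Build K (extalg K n).

Section ExteriorPowers.
Variables (K : fieldType) (n : nat).

Definition ext_gen (v : 'rV[K]_n) : extalg K n :=
  [ffun S : {set 'I_n} => \sum_(i | S == [set i]) v 0 i].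

Fact ext_gen_is_linear : linear ext_gen.
Proof.
move=> a u v; apply/ffunP => S; rewrite !ffunE scaler_sumr -big_split.
by apply: eq_bigr => i _; rewrite !mxE.
Qed.
HB.instance Definition _ :=
  GRing.isLinear.Build K 'rV[K]_n (extalg K n) _ ext_gen ext_gen_is_linear.

(* The subspace spanned by the k-fold products u_1 ^ ... ^ u_k, u_i in U. *)
Definition extpow (k : nat) (U : {vspace 'rV[K]_n}) : {vspace extalg K n} :=
  ((linfun ext_gen @: U) ^+ k)%VS.

(* For w and t of complementary degrees, w ^ t read in the top exterior power,
   which is identified with K through e_0 ^ ... ^ e_(n-1). *)
Definition wedge_form (w t : extalg K n) : K := (w * t) [set: 'I_n].

End ExteriorPowers.

Definition lagrangian (K : fieldType) (vT : vectType K) (b : vT -> vT -> K)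
    (E A : {vspace vT}) : Prop :=
  [/\ (A <= E)%VS, {in A &, forall w t, b w t = 0} & (\dim A).*2 = \dim E].

(* A linear subspace of P^(n-1) is represented by the vector subspace of K^n of
   which it is the projectivization; its points are the lines p it contains. *)
Definition incident (K : fieldType) n (U W : {vspace 'rV[K]_n}) : Prop :=
  exists p : {vspace 'rV[K]_n}, [/\ \dim p = 1%N, (p <= U)%VS & (p <= W)%VS].

(* s moves e_i to e_(s i), hence V_(i +- j, ...) to V_(s i +- s j, ...). *)
Definition perm_coord (K : fieldType) n (s : 'S_n) : 'End('rV[K]_n) :=
  linfun (col_perm s^-1%g).

Definition coord_orbit (K : fieldType) n (G : {set 'S_n})
    (V U : {vspace 'rV[K]_n}) : Prop :=
  exists2 s, s \in G & U = (perm_coord K s @: V)%VS.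

(* Below, numerals of type 'I_6 (= Z/6) stand for the indices 0, ..., 5. *)

Definition triple_transp (a b c d e f : 'I_6) : 'S_6 :=
  (tperm a b * tperm c d * tperm e f)%g.

Definition betaS5_gens : {set 'S_6} :=
  [set triple_transp 0 3 1 4 2 5; triple_transp 0 1 2 4 3 5;
       triple_transp 0 5 1 4 2 3; triple_transp 0 1 2 5 3 4].

Definition betaS5 : {group 'S_6} := <<betaS5_gens>>%G.

Section Planes.
Variable K : fieldType.

(* Signs are booleans: Z_i + Z_j = 0 for false and Z_i - Z_j = 0 for true. *)
Definition hyperplane (i : 'I_6) (s : bool) (j : 'I_6) : {vspace 'rV[K]_6} :=
  lker (linfun (fun v : 'rV[K]_6 => v 0 i + (-1) ^+ s * v 0 j : K^o)).

Definition plane (i : 'I_6) (s : bool) (j k : 'I_6) (t : bool) (l m : 'I_6)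
    (u : bool) (n : 'I_6) : {vspace 'rV[K]_6} :=
  (hyperplane i s j :&: hyperplane k t l :&: hyperplane m u n)%VS.

Definition odd_signs (i j k l m n : 'I_6) : seq {vspace 'rV[K]_6} :=
  [:: plane i true j k false l m false n; plane i false j k true l m false n;
      plane i false j k false l m true n; plane i true j k true l m true n].

Definition twenty_planes : seq {vspace 'rV[K]_6} :=
  odd_signs 0 1 2 3 4 5 ++ odd_signs 0 2 1 4 3 5 ++ odd_signs 0 3 1 5 2 4 ++
  odd_signs 0 4 1 3 2 5 ++ odd_signs 0 5 1 2 3 4.

End Planes.

(* Main.v *)
(** Two incident planes V, W span at most a 5-dimensional subspace of K^6, so
    every product of six of its vectors vanishes, and the span A of the twenty
    lines is isotropic. In a matching {i,j}, {k,l}, {m,n}, the plane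
    Z_i + a Z_j = Z_k + b Z_l = Z_m + c Z_n = 0 (a, b, c = 1 or -1) yields the
    decomposable trivector (e_j - a e_i) (e_l - b e_k) (e_n - c e_m);
    the sum of these over the four odd sign choices is
    4 (e_j e_l e_n + e_i e_k e_m). Every triple S containing 0
    is a transversal of one of the five matchings, so A contains
    e_S + c_S e_(~S) with c_S = 1 or -1 for each such S. Isotropy then forces
    these ten vectors to be a basis of A. *)

From HB Require Import structures.
Require Import Defs.
From mathcomp Require Import all_boot all_algebra all_fingroup all_field.
From mathcomp Require Import complex reals ring.

Set Implicit Arguments.
Unset Strict Implicit.
Unset Printing Implicit Defensive.

Import GRing.Theory Num.Theory.
Local Open Scope ring_scope.
Local Open Scope complex_scope.

(** * Standard basis and products of vectors in the exterior algebra *)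

Section Exterior.
Variables (K : fieldType) (n : nat).
Implicit Types (I J S T : {set 'I_n}) (x y z : extalg K n).
Implicit Types (u v : 'rV[K]_n) (U V W : {vspace 'rV[K]_n}).

Definition ebasis S : extalg K n := [ffun T : {set 'I_n} => (T == S)%:R].

Lemma extalg_mulE x y S :
  (x * y) S = \sum_(I : {set 'I_n} | I \subset S)
     (-1) ^+ inversions I (S :\: I) * (x I * y (S :\: I)).
Proof. by rewrite ffunE. Qed.

Lemma extalg_scaleE (a : K) x S : (a *: x) S = a * x S.
Proof. by rewrite ffunE. Qed.

Lemma extalg_sumE (I : Type) (r : seq I) (P : pred I) (F : I -> extalg K n) S :
  (\sum_(i <- r | P i) F i) S = \sum_(i <- r | P i) F i S.
Proof. by elim/big_rec2: _ => [|i _ y _ <-]; rewrite ffunE. Qed.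

Lemma ebasis_sum x : x = \sum_S x S *: ebasis S.
Proof.
apply/ffunP => T; rewrite extalg_sumE (bigD1 T) //= big1 => [|S nST].
  by rewrite extalg_scaleE ffunE eqxx mulr1 addr0.
by rewrite extalg_scaleE ffunE eq_sym (negPf nST) mulr0.
Qed.

Lemma ebasisM I J :
  ebasis I * ebasis J =
    if [disjoint I & J] then (-1) ^+ inversions I J *: ebasis (I :|: J) else 0.
Proof.
apply/ffunP => S; rewrite extalg_mulE.
case: (boolP ((I \subset S) && (S :\: I == J))) => [/andP[sIS /eqP dS]|nS].
  rewrite (bigD1 I) //= big1 => [|T /andP[_ /negPf nTI]]; last first.
    by rewrite !ffunE nTI mul0r mulr0.
  rewrite -dS !ffunE !eqxx disjoint_sym disjoints_subset setDE subsetIr.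
  rewrite extalg_scaleE ffunE setUIr setUCr setIT.
  by rewrite (setUidPr sIS) eqxx !mulr1 addr0.
rewrite big1 => [|T sTS]; last first.
  rewrite !ffunE; have [eTI|_] := eqVneq T I; last by rewrite mul0r mulr0.
  by move: nS; rewrite -eTI sTS /= => /negPf ->; rewrite mulr0 mulr0.
case: ifP => [dIJ|_]; last by rewrite ffunE.
rewrite extalg_scaleE ffunE; have [eS|_] := eqVneq S (I :|: J); last by rewrite mulr0.
move: nS; rewrite eS subsetUl setDUl setDv set0U /=.
by rewrite disjoint_sym in dIJ; move/setDidPl: dIJ => ->; rewrite eqxx.
Qed.

Lemma ext_gen_delta i : ext_gen (delta_mx 0 i) = ebasis [set i] :> extalg K n.
Proof.
apply/ffunP => S; rewrite !ffunE; case: eqP => [->|nS].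
  rewrite (bigD1 i) //= mxE !eqxx big1 ?addr0 // => j /andP[/eqP/set1_inj <-].
  by rewrite eqxx.
rewrite big1 // => j /eqP eS; rewrite mxE eqxx /=; case: eqP => // eji.
by rewrite eS eji in nS.
Qed.

Lemma ext_gen_deltaC i j :
  ext_gen (delta_mx 0 i) * ext_gen (delta_mx 0 j) =
    - (ext_gen (delta_mx 0 j) * ext_gen (delta_mx 0 i)) :> extalg K n.
Proof.
rewrite !ext_gen_delta !ebasisM (disjoint_sym [set j]) setUC.
rewrite disjoints1 inE; have [_|nij] := eqVneq; first by rewrite oppr0.
rewrite /= /inversions !big_set1 -scaleNr; congr (_ *: _).
by case: ltngtP nij => [||/val_inj->]; rewrite ?eqxx ?expr0 ?expr1 ?opprK.
Qed.

Lemma ext_gen_sum v :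
  ext_gen v = \sum_i v 0 i *: ext_gen (delta_mx 0 i) :> extalg K n.
Proof.
by rewrite {1}[v]row_sum_delta linear_sum; apply: eq_bigr => i _; rewrite linearZ.
Qed.

Lemma ext_genC u v : ext_gen u * ext_gen v = - (ext_gen v * ext_gen u).
Proof.
rewrite (ext_gen_sum u) (ext_gen_sum v) !mulr_suml -sumrN.
under eq_bigr do rewrite mulr_sumr.
under [RHS]eq_bigr do rewrite mulr_sumr -sumrN.
rewrite exchange_big; apply: eq_bigr => j _; apply: eq_bigr => i _ /=.
by rewrite -!scalerAl -!scalerAr ext_gen_deltaC !scalerN !scalerA mulrC.
Qed.

(** Squares of basis vectors vanish and cross terms cancel by anticommutativity; no division by 2
    occurs, so the argument is valid in every characteristic. *)
Lemma ext_gen_sqr v : ext_gen v * ext_gen v = 0.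
Proof.
rewrite [v]row_sum_delta; elim/big_ind: _ => [|x y x0 y0|i _].
- by rewrite linear0 mul0r.
- by rewrite linearD mulrDl !mulrDr x0 y0 (ext_genC x y) addr0 add0r addNr.
rewrite linearZ /= -scalerAl -scalerAr ext_gen_delta ebasisM.
by rewrite disjoints1 inE eqxx !scaler0.
Qed.

(** * Exterior powers of subspaces *)

Lemma mem_ext_gen v U : v \in U -> ext_gen v \in (linfun (@ext_gen K n) @: U)%VS.
Proof. by move=> vU; rewrite -[ext_gen v]lfunE memv_img. Qed.

Lemma mem_extpow3 U u v w : u \in U -> v \in U -> w \in U ->
  ext_gen u * ext_gen v * ext_gen w \in extpow 3 U.
Proof.
move=> uU vU wU; rewrite /extpow expvSr expv2.
by rewrite !memv_mul ?mem_ext_gen.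
Qed.

Lemma extpowS k U V : (U <= V)%VS -> (extpow k U <= extpow k V)%VS.
Proof. by move=> sUV; apply/expvS/limgS. Qed.

(** A factor v can be moved to the front of a product at the cost of a sign ([ML]), and v squares to
    zero ([LL]), so v survives at most once. *)
Lemma extpow_addv_line k v U :
  (extpow k.+1 (<[v]> + U) <=
     extpow k.+1 U + <[ext_gen v]> * extpow k U)%VS.
Proof.
rewrite /extpow limgD limg_line lfunE /=.
set L := <[ext_gen v]>%VS; set M := (_ @: U)%VS.
elim: k => [|k IHk]; first by rewrite !expv1 expv0 prodv1 addvC.
rewrite expvSl (subv_trans (prodvSr _ IHk)) //.
have LL : (L * L = 0)%VS.
  by rewrite prodv_line ext_gen_sqr; apply/eqP; rewrite -dimv_eq0 dim_vline eqxx.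
have ML : (M * L <= L * M)%VS.
  apply/prodvP => _ _ /memv_imgP[u uU ->] /vlineP[a ->].
  rewrite lfunE /= -scalerAr ext_genC memvZ // memvN.
  by rewrite memv_mul ?memv_line ?mem_ext_gen.
rewrite prodvDl !prodvDr !prodvA LL prod0v addv0.
rewrite !subv_add addvSr -expvSl addvSl /=.
apply: subv_trans (addvSr _ _).
by rewrite [X in (_ <= _ * X)%VS]expvSl prodvA prodvSl.
Qed.

(** Induction on the dimension: after a line is split off from U, both terms of [extpow_addv_line]
    vanish by the induction hypothesis. *)
Lemma extpow_eq0 k U : (\dim U < k)%N -> extpow k U = 0%VS.
Proof.
elim: {U}(\dim U) {-2}U (erefl (\dim U)) k => [|d IHd] U dU [|k] // ltdk.
  have -> : U = 0%VS by apply/eqP; rewrite -dimv_eq0 dU.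
  by rewrite /extpow limg0 expvSl prod0v.
have nzU : vpick U != 0 by rewrite vpick0 -dimv_eq0 dU.
have := memv_pick U; move: (vpick U) nzU => v nzv Uv.
have capU : (U :&: <[v]> = <[v]>)%VS by apply/capv_idPr; rewrite -memvE.
have dU' : \dim (U :\: <[v]>) = d.
  by have := dimv_cap_compl U <[v]>; rewrite capU dim_vline nzv dU add1n => -[].
rewrite -(addv_diff_cap U <[v]>) capU addvC; rewrite dU in ltdk.
apply/subv_anti; rewrite sub0v andbT (subv_trans (extpow_addv_line _ _ _)) //.
by rewrite !IHd ?dU' // ?prodv0 ?addv0 ?subvv // ltnW.
Qed.

Lemma extpowM_eq0 j k U W x y : (\dim (U + W) < j + k)%N ->
  x \in extpow j U -> y \in extpow k W -> x * y = 0.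
Proof.
move=> dUW xU yW; apply/eqP; rewrite -memv0 -(extpow_eq0 dUW) /extpow expvD.
apply: memv_mul.
  exact: (subvP (extpowS j (addvSl U W))).
exact: (subvP (extpowS k (addvSr U W))).
Qed.

(** * Coordinates and bases of the exterior powers *)

Lemma span_coord_eq0 (X : seq (extalg K n)) S x :
  {in X, forall y, y S = 0} -> x \in <<X>>%VS -> x S = 0.
Proof.
move=> X0 /(@coord_span _ _ _ (in_tuple X)) ->; rewrite extalg_sumE big1 // => i _.
by rewrite extalg_scaleE X0 ?mulr0 // mem_nth.
Qed.

Lemma mem_span_ebasis (P : {set {set 'I_n}}) x :
  (x \in <<[seq ebasis T | T <- enum P]>>%VS) <-> (forall S, S \notin P -> x S = 0).
Proof.
split=> [xP S nPS | x0].
  apply: span_coord_eq0 xP => _ /mapP[T PT ->]; rewrite ffunE.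
  by case: eqP PT nPS => // ->; rewrite mem_enum => ->.
rewrite [x]ebasis_sum memv_suml // => S _.
have [PS|/x0->] := boolP (S \in P); last by rewrite scale0r mem0v.
by rewrite memvZ // memv_span // map_f // mem_enum.
Qed.

(** The coordinate at S is 1 on [F S] and vanishes on the span of the remaining vectors, which
    therefore does not contain [F S]. *)
Lemma free_coords (P : seq {set 'I_n}) (F : {set 'I_n} -> extalg K n) :
    uniq P -> {in P &, forall S T, F S T = (S == T)%:R} ->
  free [seq F T | T <- P].
Proof.
elim: P => [|S P IHP] /=; first by rewrite nil_free.
move=> /andP[nPS uP] FP; rewrite free_cons IHP //; last first.
  by move=> T T' PT PT'; rewrite FP ?inE ?PT ?PT' ?orbT.
rewrite andbT; apply: contraTN isT => /(span_coord_eq0 (S := S)).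
rewrite FP ?inE ?eqxx // => FS0; suff /eqP: (1 : K) = 0 by rewrite oner_eq0.
apply: FS0 => _ /mapP[T PT ->]; rewrite FP ?inE ?eqxx ?PT ?orbT //.
by case: eqP PT nPS => // -> ->.
Qed.

Lemma mem_ebasis_extpow S : ebasis S \in extpow #|S| fullv.
Proof.
move Dk: #|S| => k; elim: k S Dk => [|k IHk] S Dk.
  rewrite /extpow expv0 (cards0_eq Dk); apply/vlineP; exists 1.
  by rewrite scale1r; apply/ffunP => T; rewrite !ffunE.
have /card_gt0P[i Si] : (0 < #|S|)%N by rewrite Dk.
have Dk' : #|S :\ i| = k by move: Dk; rewrite (cardsD1 i) Si => -[].
have : ext_gen (delta_mx 0 i) * ebasis (S :\ i) \in extpow k.+1 fullv.
  by rewrite /extpow expvSl memv_mul ?IHk ?mem_ext_gen ?memvf.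
rewrite ext_gen_delta ebasisM disjoints1 !inE eqxx setD1K //=.
by rewrite rpredZsign.
Qed.

Lemma extpow_fullv k :
  extpow k fullv = <<[seq ebasis T | T <- enum [set T : {set 'I_n} | #|T| == k]]>>%VS.
Proof.
apply/eqP; rewrite eqEsubv; apply/andP; split; last first.
  by apply/span_subvP => _ /mapP[S + ->]; rewrite mem_enum inE => /eqP <-;
    apply: mem_ebasis_extpow.
elim: k => [|k IHk].
  rewrite /extpow expv0 -memvE; apply/mem_span_ebasis => S.
  by rewrite inE cards_eq0 ffunE => /negPf ->.
rewrite /extpow expvSl (subv_trans (prodvSr _ IHk)) //.
apply/prodvP => _ x /memv_imgP[u _ ->] /mem_span_ebasis x0.
apply/mem_span_ebasis => S; rewrite inE lfunE /= => nS.
(* A vector has coefficients on singletons only, so each nonzero term evaluates [x] on a set with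
   one element less than S. *)
rewrite extalg_mulE big1 // => I sIS; rewrite ffunE.
have [I1|nI1] := boolP (#|I| == 1%N); last first.
  by rewrite big1 ?mul0r ?mulr0 // => i /eqP eI; rewrite eI cards1 in nI1.
rewrite x0 ?mulr0 // inE cardsDS // (eqP I1) subn1.
by apply: contraNneq nS => <-; rewrite prednK //
  (leq_trans _ (subset_leq_card sIS)) ?(eqP I1).
Qed.

Lemma mem_extpow_fullv k x :
  (x \in extpow k fullv) <-> (forall S, #|S| != k -> x S = 0).
Proof.
rewrite extpow_fullv; apply: (iff_trans (mem_span_ebasis _ _)).
by split=> x0 S => [nS|]; [apply: x0 | move=> nS; apply: x0; move: nS]; rewrite inE.
Qed.

Lemma dim_extpow_fullv k :
  \dim (extpow k fullv : {vspace extalg K n}) =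
    #|[set T : {set 'I_n} | #|T| == k]|.
Proof.
rewrite extpow_fullv (eqnP (free_coords _ _)) ?enum_uniq ?size_map ?cardE //.
by move=> S T _ _; rewrite ffunE eq_sym.
Qed.

(** * A criterion for Lagrangian subspaces in the middle degree *)

Lemma wedge_form_ebasisC (c : K) S y : y S = 0 ->
  wedge_form y (ebasis S + c *: ebasis (~: S)) = 0 -> y (~: S) = 0.
Proof.
(* Only I = ~S and I = S can contribute to the top coefficient, and the second term dies with y S;
   the pairing is thus y (~S) up to sign. *)
move=> yS0; rewrite /wedge_form extalg_mulE (bigD1 (~: S)) ?subsetT //=.
rewrite big1 => [|I /andP[_ nIS]]; last first.
  rewrite setTD !ffunE (can2_eq (@setCK _) (@setCK _)) (negPf nIS) add0r.
  rewrite (inj_eq (can_inj (@setCK _))).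
  have [->|_] := eqVneq I S; first by rewrite yS0 mul0r mulr0.
  by rewrite /= scaler0 !mulr0.
rewrite addr0 setTD setCK !ffunE eqxx.
(* A set equals its complement only for n = 0; then the hypothesis on y S is the claim. *)
have [eSC|_] := eqVneq S (~: S); first by move=> _; rewrite -eSC.
rewrite /= scaler0 addr0 mulr1 => /eqP.
by rewrite mulf_eq0 signr_eq0 => /eqP.
Qed.

(** For n = 2h, complementation exchanges the h-subsets that contain i0 with those that avoid it. *)
Lemma card_halves h i0 : n = h.*2 ->
  #|[set T : {set 'I_n} | #|T| == h]| =
    #|[set T : {set 'I_n} | (i0 \in T) && (#|T| == h)]|.*2.
Proof.
move=> Dn; set P := [set T | _ && _].
rewrite -addnn -{2}(card_imset (mem P) (can_inj (@setCK _))).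
rewrite -(cardsID [set T : {set 'I_n} | i0 \in T]); congr (_ + _)%N.
  by apply: eq_card => T; rewrite !inE andbC.
apply: eq_card => T; rewrite -[T in RHS]setCK mem_imset; last exact: can_inj (@setCK _).
rewrite !inE; congr (_ && _).
have leT : (#|T| <= h.*2)%N.
  by rewrite -Dn; apply: leq_trans (max_card _) _; rewrite card_ord.
have -> : #|~: T| = (h.*2 - #|T|)%N by rewrite -Dn cardsCs setCK card_ord.
rewrite -addnn in leT *.
apply/eqP/eqP => [->|eT]; first by rewrite addnK.
by rewrite -(subKn leT) eT addnK.
Qed.

(* Subtract from x in A a combination of the given elements so that x S = 0
   for every S containing i0; pairing the result with these elements shows
   that it also vanishes on the complements, so they form a basis of A. *)
Lemma lagrangian_of_halves h i0 (A : {vspace extalg K n}) : n = h.*2 ->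
    (A <= extpow h fullv)%VS ->
    {in A &, forall x y, wedge_form x y = 0} ->
    (forall S, i0 \in S -> #|S| = h ->
       exists c : K, ebasis S + c *: ebasis (~: S) \in A) ->
  lagrangian (@wedge_form K n) (extpow h fullv) A.
Proof.
move=> Dn sAE isoA halves; split=> //.
set P := [set T : {set 'I_n} | (i0 \in T) && (#|T| == h)].
have /fin_all_exists[c cA] (S : {set 'I_n}) : exists c : K,
    S \in P -> ebasis S + c *: ebasis (~: S) \in A.
  (* Outside [P] the coefficient defaults to 0, which makes [c] a total function. *)
  have [|nPS] := boolP (S \in P); last by exists 0.
  by rewrite inE => /andP[Si0 /eqP S3]; have [c] := halves S Si0 S3; exists c.
pose F S := ebasis S + c S *: ebasis (~: S).
have FE S T : i0 \in S -> i0 \in T -> F S T = (S == T)%:R.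
  (* Two sets containing i0 are never complementary, so on [P] the elements F S are dual to the
     coordinates. *)
  move=> Si0 Ti0; rewrite !ffunE eq_sym [T == ~: S](_ : _ = false) ?scaler0 ?addr0 //.
  by apply: contraTF Ti0 => /eqP ->; rewrite inE Si0.
have freeF : free [seq F T | T <- enum P].
  apply: free_coords => [|S T]; first exact: enum_uniq.
  by rewrite !mem_enum !inE => /andP[Si0 _] /andP[Ti0 _]; apply: FE.
suff -> : A = <<[seq F T | T <- enum P]>>%VS.
  by rewrite (eqnP freeF) size_map -cardE dim_extpow_fullv (card_halves i0 Dn).
apply/subv_anti/andP; split; last first.
  by apply/span_subvP => _ /mapP[T + ->]; rewrite mem_enum => /cA.
apply/subvP => x Ax; set z := \sum_(S in P) x S *: F S.
have FA S : S \in P -> F S \in A by move/cA.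
have zA : z \in A by apply: memv_suml => S /FA FSA; rewrite memvZ.
have yA : x - z \in A by rewrite memvB.
have yP S : S \in P -> (x - z) S = 0.
  move=> PS; have Si0: i0 \in S by move: PS; rewrite inE => /andP[].
  rewrite !ffunE extalg_sumE (bigD1 S) //= extalg_scaleE FE // eqxx mulr1.
  rewrite big1 ?addr0 ?subrr // => T /andP[]; rewrite inE => /andP[Ti0 _] /negPf nTS.
  by rewrite extalg_scaleE FE // nTS mulr0.
have -> : x = z.
  apply/eqP; rewrite -subr_eq0; apply/eqP/ffunP => S; rewrite [RHS]ffunE.
  have [Sh|nSh] := eqVneq #|S| h; last first.
    exact: (mem_extpow_fullv h _).1 (subvP sAE _ yA) S nSh.
  have [Si0|nSi0] := boolP (i0 \in S); first by rewrite yP // inE Si0 Sh eqxx.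
  have PCS : ~: S \in P.
    by rewrite !inE nSi0 cardsCs setCK card_ord Sh Dn -addnn addnK eqxx.
  rewrite -[S]setCK; apply: (@wedge_form_ebasisC (c (~: S))); first exact: yP.
  by apply: isoA => //; apply: FA.
by apply: memv_suml => S PS; rewrite memvZ // memv_span // map_f // mem_enum.
Qed.

Lemma ext_gen_mul3 a b c : uniq [:: a; b; c] ->
  exists s : bool,
    ext_gen (delta_mx 0 a) * ext_gen (delta_mx 0 b) * ext_gen (delta_mx 0 c) =
      (-1) ^+ s *: ebasis [set a; b; c].
Proof.
rewrite /= !inE negb_or andbT => /andP[/andP[ab ac] bc].
rewrite !ext_gen_delta ebasisM disjoints1 inE ab -scalerAl ebasisM.
rewrite disjoint_sym disjoints1 !inE negb_or ![c == _]eq_sym ac bc scalerA -exprD.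
by rewrite -signr_odd; eexists.
Qed.

End Exterior.

(** * Systems of signed equations and finite checks on them *)

(* An equation (i, s, j) stands for Z_i + (-1)^s Z_j = 0. *)
Definition eqn : Type := ('I_6 * bool * 'I_6)%type.
Definition system : Type := seq eqn.

(** Integer vectors make the finite checks computable and independent of the field;
    [mem_solutions_int_row] transfers the results. *)
Definition satisfies (w : seq int) (E : system) : bool :=
  all (fun e : eqn => w`_(e.1.1) + (-1) ^+ e.1.2 * w`_(e.2) == 0) E.

Definition eqn_flip (e : eqn) : eqn := (e.2, e.1.2, e.1.1).

(** A syntactic test: an equation may occur with its two indices exchanged, since this only
    multiplies it by a sign. *)
Definition system_sub (E E' : system) : bool :=
  all (fun e : eqn => (e \in E') || (eqn_flip e \in E')) E.

Definition system_map (f : 'I_6 -> 'I_6) (E : system) : system :=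
  [seq (f e.1.1, e.1.2, f e.2) | e : eqn <- E].

Definition signed_system (i : 'I_6) (s : bool) (j k : 'I_6) (t : bool)
    (l m : 'I_6) (u : bool) (n : 'I_6) : system :=
  [:: (i, s, j); (k, t, l); (m, u, n)].

Definition odd_systems (i j k l m n : 'I_6) : seq system :=
  [:: signed_system i true j k false l m false n;
      signed_system i false j k true l m false n;
      signed_system i false j k false l m true n;
      signed_system i true j k true l m true n].

Definition matchings : seq (('I_6 * 'I_6) * ('I_6 * 'I_6) * ('I_6 * 'I_6)) :=
  [:: ((0, 1), (2, 3), (4, 5)); ((0, 2), (1, 4), (3, 5));
      ((0, 3), (1, 5), (2, 4)); ((0, 4), (1, 3), (2, 5));
      ((0, 5), (1, 2), (3, 4))].

Definition systems : seq system :=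
  flatten [seq odd_systems M.1.1.1 M.1.1.2 M.1.2.1 M.1.2.2 M.2.1 M.2.2
          | M <- matchings].

(* Two planes of the same matching share an equation Z_i + Z_j = 0 or
   Z_i - Z_j = 0, so they meet in e_i - e_j or e_i + e_j. Two different matchings
   form a hexagon along which the signs are consistent, as both are odd, so
   their planes meet in a vector with entries 1 and -1. *)
Definition witnesses : seq (seq int) :=
  [seq mkseq (fun a => (a == p.1)%:R + e * (a == p.2)%:R) 6
    | p : 'I_6 * 'I_6 <- flatten [seq [:: M.1.1; M.1.2; M.2] | M <- matchings],
      e <- [:: 1; -1]]
  ++ iter 6 (fun ws => [seq a :: w | a <- [:: 1; -1], w <- ws]) [:: [::]].

Lemma systems_meet :
  all (fun E => all (fun E' =>
    has (fun w => [&& has (fun i : 'I_6 => w`_i != 0) [:: 0; 1; 2; 3; 4; 5],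
                      satisfies w E & satisfies w E'])
      witnesses) systems) systems.
Proof. by lazy. Qed.

(** A witness solving one system but not the other separates their solution spaces; this makes the
    twenty planes distinct. *)
Lemma systems_separated :
  all (fun E => all (fun E' =>
    (E == E') || has (fun w => satisfies w E && ~~ satisfies w E') witnesses)
  systems) systems.
Proof. by lazy. Qed.

(** A version of [triple_transp] that evaluates by table lookup; the default [i] fixes every index
    outside the table. *)
Definition triple_swap (a b c d e f i : 'I_6) : 'I_6 :=
  nth i [:: b; a; d; c; f; e] (index i [:: a; b; c; d; e; f]).

Definition generator_maps : seq ('I_6 -> 'I_6) :=
  [:: triple_swap 0 3 1 4 2 5; triple_swap 0 1 2 4 3 5;
      triple_swap 0 5 1 4 2 3; triple_swap 0 1 2 5 3 4].

(** Invariance of the set of planes under the four generators, reduced to a finite comparison of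
    equations. *)
Lemma systems_stable :
  all (fun f => all (fun E => has (fun E' =>
    system_sub (system_map f E) E' && system_sub E' (system_map f E))
  systems) systems) generator_maps.
Proof. by lazy. Qed.

Definition minus_base : system := signed_system 0 true 1 2 true 3 4 true 5.
Definition plus_base : system := signed_system 0 false 1 2 false 3 4 true 5.

(* For each system, the indices of the generators to be applied in turn to one
   of the two base systems, which is [minus_base] when the flag is set. *)
Definition orbit_words : seq (bool * seq nat) :=
  [:: (false, [:: 2]); (false, [:: 1]); (false, [::]); (true, [::]);
      (false, [:: 0; 1; 2; 3]); (false, [:: 0; 1; 2; 1; 3]);
      (false, [:: 0; 1; 0; 2; 3]); (true, [:: 0; 1; 2; 3]);
      (false, [:: 0; 1; 2; 1]); (false, [:: 0; 1; 2]);
      (false, [:: 0; 1; 0; 2]); (true, [:: 0; 1; 2]);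
      (false, [:: 0; 1]); (false, [:: 0; 1; 0]); (false, [:: 0; 2; 1]);
      (true, [:: 0; 1]); (false, [:: 0; 3]); (false, [:: 0]);
      (false, [:: 0; 2]); (true, [:: 0])]%N.

Lemma systems_reached :
  all (fun E => has (fun bw : bool * seq nat =>
      let E' := foldl (fun E' a => system_map (nth id generator_maps a) E')
        (if bw.1 then minus_base else plus_base) bw.2 in
      system_sub E E' && system_sub E' E)
    orbit_words) systems.
Proof. by lazy. Qed.

(** * Solution spaces over a field of characteristic zero *)

Section Solutions.
Variable K : numFieldType.
Implicit Types (E : system) (w : seq int) (v : 'rV[K]_6) (b : bool).

Definition solutions E : {vspace 'rV[K]_6} :=
  (\bigcap_(e <- E) hyperplane K (e : eqn).1.1 e.1.2 e.2)%VS.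

(** The function inside [hyperplane], named so that it can carry a linear structure; [lfunE] then
    evaluates its [linfun]. *)
Definition equation_form (i : 'I_6) (b : bool) (j : 'I_6) v : K^o :=
  v 0 i + (-1) ^+ b * v 0 j.

Fact equation_form_is_linear i b j : linear (equation_form i b j).
Proof.
move=> a u v; rewrite /equation_form !mxE -[a *: _]/(a * _).
by rewrite !mulrDr mulrCA -!addrA; congr (_ + _); rewrite addrCA.
Qed.
HB.instance Definition _ i b j :=
  GRing.isLinear.Build K 'rV[K]_6 K^o _ (equation_form i b j)
    (equation_form_is_linear i b j).

Lemma mem_hyperplane i b j v :
  (v \in hyperplane K i b j) = (v 0 i + (-1) ^+ b * v 0 j == 0).
Proof. by rewrite memv_ker (lfunE (equation_form i b j)). Qed.

Lemma mem_solutions E v :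
  (v \in solutions E) =
    all (fun e : eqn => v 0 e.1.1 + (-1) ^+ e.1.2 * v 0 e.2 == 0) E.
Proof.
rewrite /solutions; elim: E => [|e E IHE]; first by rewrite big_nil memvf.
by rewrite big_cons memv_cap IHE mem_hyperplane.
Qed.

Lemma plane_solutions i s j k t l m u n :
  plane K i s j k t l m u n = solutions (signed_system i s j k t l m u n).
Proof. by rewrite /solutions !big_cons big_nil capvf capvA. Qed.

Lemma odd_signs_solutions i j k l m n :
  odd_signs K i j k l m n = map solutions (odd_systems i j k l m n).
Proof. by rewrite /= -!plane_solutions. Qed.

Lemma twenty_planes_flatten :
  twenty_planes K =
    flatten [seq odd_signs K M.1.1.1 M.1.1.2 M.1.2.1 M.1.2.2 M.2.1 M.2.2
            | M <- matchings].
Proof. by []. Qed.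

Lemma twenty_planes_solutions : twenty_planes K = map solutions systems.
Proof.
rewrite twenty_planes_flatten /systems map_flatten -map_comp; congr flatten.
by apply: eq_map => M; rewrite odd_signs_solutions.
Qed.

Definition int_row w : 'rV[K]_6 := \row_i (w`_i)%:~R.

(** In characteristic zero an integer vanishes in K exactly when it is zero, so the integer checks
    decide membership over K. *)
Lemma mem_solutions_int_row w E : (int_row w \in solutions E) = satisfies w E.
Proof.
rewrite mem_solutions; apply: eq_all => e /=; rewrite !mxE.
by rewrite -(intr_eq0 K) rmorphD rmorphM rmorph_sign.
Qed.

Lemma solutions_sub E E' : system_sub E E' -> (solutions E' <= solutions E)%VS.
Proof.
move=> /allP sEE'; apply/subvP => v; rewrite !mem_solutions => /allP vE'.
apply/allP => e /sEE' /orP[/vE' //|/vE' /= ve].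
(* With s = 1 or -1, Z_i + s Z_j = s (Z_j + s Z_i). *)
by rewrite -[v 0 e.1.1](signrMK e.1.2) -mulrDr mulf_eq0 signr_eq0 addrC.
Qed.

Lemma solutions_eq E E' :
  system_sub E E' && system_sub E' E -> solutions E = solutions E'.
Proof.
by move=> /andP[sEE' sE'E]; apply/subv_anti; rewrite !solutions_sub.
Qed.

Lemma twenty_planes_incident : {in twenty_planes K &, forall U W, incident U W}.
Proof.
rewrite twenty_planes_solutions => _ _ /mapP[E sE ->] /mapP[E' sE' ->].
have /allP/(_ E sE)/allP/(_ E' sE') /hasP[w _ /and3P[/hasP[i _ wi] wE wE']] :=
  systems_meet.
exists <[int_row w]>%VS; rewrite -!memvE !mem_solutions_int_row wE wE'.
split=> //; rewrite dim_vline; case: eqP => // /rowP/(_ i)/eqP.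
by rewrite !mxE intr_eq0 (negPf wi).
Qed.

Lemma twenty_planes_uniq : uniq (twenty_planes K).
Proof.
rewrite twenty_planes_solutions map_inj_in_uniq => [|E E' sE sE' eEE'].
  by lazy.
have /allP/(_ E sE)/allP/(_ E' sE') /orP[/eqP //|/hasP[w _]] :=
  systems_separated.
by rewrite -!mem_solutions_int_row eEE' andbN.
Qed.

(** * The action of permutations and the two orbits *)

Lemma perm_coordE (s : 'S_6) v i : perm_coord K s v 0 (s i) = v 0 i.
Proof. by rewrite lfunE mxE permK. Qed.

Lemma perm_coordM (s t : 'S_6) v :
  perm_coord K (s * t)%g v = perm_coord K t (perm_coord K s v).
Proof.
apply/rowP => j; rewrite -(permKV (s * t)%g j) perm_coordE.
by rewrite permM !perm_coordE.
Qed.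

Lemma perm_coord1 v : perm_coord K 1 v = v.
Proof. by apply/rowP => j; rewrite -{1}(perm1 j) perm_coordE. Qed.

Lemma limg_perm_coordM (s t : 'S_6) (U : {vspace 'rV[K]_6}) :
  (perm_coord K (s * t)%g @: U = perm_coord K t @: (perm_coord K s @: U))%VS.
Proof.
rewrite -limg_comp; congr (_ @: _)%VS; apply/lfunP => v.
by rewrite comp_lfunE perm_coordM.
Qed.

Lemma limg_perm_coord1 (U : {vspace 'rV[K]_6}) : (perm_coord K 1 @: U = U)%VS.
Proof.
rewrite (_ : perm_coord K 1 = \1%VF) ?lim1g //; apply/lfunP => v.
by rewrite id_lfunE perm_coord1.
Qed.

Lemma perm_coord_solutions (s : 'S_6) E :
  (perm_coord K s @: solutions E)%VS = solutions (system_map s E).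
Proof.
have permP v : (perm_coord K s v \in solutions (system_map s E)) = (v \in solutions E).
  rewrite !mem_solutions all_map; apply: eq_all => e /=.
  by rewrite !perm_coordE.
apply/vspaceP => v; apply/memv_imgP/idP => [[u uE ->]|vE]; first by rewrite permP.
have vK : perm_coord K s (perm_coord K s^-1 v) = v.
  by rewrite -perm_coordM mulVg perm_coord1.
by exists (perm_coord K s^-1 v) => //; rewrite -permP vK.
Qed.

Definition generator (a : nat) : 'S_6 :=
  nth 1%g [:: triple_transp 0 3 1 4 2 5; triple_transp 0 1 2 4 3 5;
              triple_transp 0 5 1 4 2 3; triple_transp 0 1 2 5 3 4] a.

Lemma generatorE a : generator a =1 nth id generator_maps a.
Proof.
(* From index 4 on, both lists return their default, the identity. *)
case: a => [|[|[|[|a]]]] x; rewrite /generator /= ?nth_nil ?perm1 //;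
  by rewrite /triple_transp !permM !permE; case: x => [[|[|[|[|[|[|//]]]]]] ?];
  apply/val_inj.
Qed.

Lemma mem_betaS5_gens s :
  s \in betaS5_gens -> exists2 a, (a < 4)%N & s = generator a.
Proof.
rewrite !inE -!orbA => /or4P[] /eqP ->;
  by [exists 0%N | exists 1%N | exists 2%N | exists 3%N].
Qed.

Lemma generator_betaS5 a : generator a \in betaS5.
Proof.
case: a => [|[|[|[|a]]]]; last by rewrite /generator /= nth_nil group1.
all: by apply: mem_gen; rewrite !inE eqxx ?orbT.
Qed.

Lemma limg_generator a E :
  (perm_coord K (generator a) @: solutions E)%VS =
    solutions (system_map (nth id generator_maps a) E).
Proof.
rewrite perm_coord_solutions /system_map; congr solutions.
by apply: eq_map => e; rewrite !generatorE.
Qed.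

(** Every element of the generated group is a product of generators, so stability under each
    generator suffices. *)
Lemma twenty_planes_stable (s : 'S_6) U :
  s \in betaS5 -> U \in twenty_planes K ->
  (perm_coord K s @: U)%VS \in twenty_planes K.
Proof.
case/gen_prodgP=> r [c c_gen ->]; elim/big_ind: _ U => [U|s1 s2 IH1 IH2 U UP|i _ U].
- by rewrite limg_perm_coord1.
- by rewrite limg_perm_coordM IH2 ?IH1.
have [a lta4 ->] := mem_betaS5_gens (c_gen i).
rewrite twenty_planes_solutions => /mapP[E sE ->]; rewrite limg_generator.
have /allP/(_ E sE)/hasP[E' sE' /solutions_eq ->] :=
  all_nthP id systems_stable a lta4.
exact: map_f.
Qed.

(** [foldl] applies the first letter first, which agrees with the left-to-right product of
    permutations. *)
Lemma solutions_word (l : seq nat) E : exists2 s, s \in betaS5 &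
  solutions (foldl (fun E' a => system_map (nth id generator_maps a) E') E l) =
    (perm_coord K s @: solutions E)%VS.
Proof.
elim: l E => [|a l IHl] E /=.
  by exists 1%g; rewrite ?group1 ?limg_perm_coord1.
have [s sG ->] := IHl (system_map (nth id generator_maps a) E).
exists (generator a * s)%g; first by rewrite groupM ?generator_betaS5.
by rewrite limg_perm_coordM limg_generator.
Qed.

(** The tabulated words carry a base plane to each of the twenty; conversely both base planes are in
    the list, which is stable under the group. *)
Lemma twenty_planes_orbits U :
  U \in twenty_planes K <->
    coord_orbit betaS5 (plane K 0 true 1 2 true 3 4 true 5) U \/
    coord_orbit betaS5 (plane K 0 false 1 2 false 3 4 true 5) U.
Proof.
split=> [|[] [s sG ->]].
- rewrite twenty_planes_solutions => /mapP[E sE ->].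
  have /allP/(_ E sE)/hasP[[b l] _ /= /solutions_eq ->] := systems_reached.
  have [s sG ->] := solutions_word l (if b then minus_base else plus_base).
  by rewrite !plane_solutions; case: b; [left | right]; exists s.
- apply: twenty_planes_stable => //; rewrite twenty_planes_solutions.
  by rewrite plane_solutions map_f.
apply: twenty_planes_stable => //; rewrite twenty_planes_solutions.
by rewrite plane_solutions map_f.
Qed.

(** * Dimension of the planes *)

Lemma dim_hyperplane i b j : (5 <= \dim (hyperplane K i b j))%N.
Proof.
rewrite -[hyperplane _ _ _ _]capfv /hyperplane.
have := limg_ker_dim (linfun (equation_form i b j)) fullv.
rewrite [\dim fullv]dimvf /dim /= => dim6.
by rewrite -(leq_add2r 1) -[(5 + 1)%N]dim6 leq_add2l
  (leq_trans (dimvS (subvf _))) // dimvf.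
Qed.

Lemma dim_plane_ge3 i s j k t l m u n : (3 <= \dim (plane K i s j k t l m u n))%N.
Proof.
have capP (U V : {vspace 'rV[K]_6}) d :
    (d.+1 <= \dim U -> 5 <= \dim V -> d <= \dim (U :&: V))%N.
  move=> dU dV; rewrite -(leq_add2l 6); apply: (@leq_trans (\dim U + \dim V)).
    by rewrite addSnnS addnC leq_add.
  rewrite -dimv_sum_cap leq_add2r (leq_trans (dimvS (subvf _))) // dimvf.
  by rewrite /dim /= mul1n.
by do 2?[apply: (capP)]; apply: dim_hyperplane.
Qed.

(** The plane with all three signs reversed meets this one in 0. Both have dimension at least 3
    inside a space of dimension 6, so both have dimension exactly 3. *)
Lemma dim_plane i s j k t l m u n : uniq [:: i; j; k; l; m; n] ->
  \dim (plane K i s j k t l m u n) = 3%N.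
Proof.
move=> uI; apply/eqP; rewrite eqn_leq dim_plane_ge3 andbT.
have capN a b c (v : 'rV[K]_6) :
    v \in hyperplane K a b c -> v \in hyperplane K a (~~ b) c ->
    v 0 a = 0 /\ v 0 c = 0.
  rewrite !mem_hyperplane signrN mulNr => /eqP v1 /eqP v2.
  have va : v 0 a = 0.
    have: v 0 a *+ 2 = 0 by rewrite mulr2n -[RHS]addr0 -{1}v1 -v2 addrACA subrr addr0.
    by move/eqP; rewrite mulrn_eq0 => /eqP.
  by move: v1; rewrite va add0r => /eqP; rewrite mulf_eq0 signr_eq0 => /eqP.
have cap0 : (plane K i s j k t l m u n :&:
             plane K i (~~ s) j k (~~ t) l m (~~ u) n = 0)%VS.
  apply/eqP; rewrite -subv0; apply/subvP => v; rewrite !memv_cap memv0.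
  case/andP=> /andP[/andP[vi vk] vm] /andP[/andP[vi' vk'] vm'].
  have [vi0 vj0] := capN _ _ _ _ vi vi'; have [vk0 vl0] := capN _ _ _ _ vk vk'.
  have [vm0 vn0] := capN _ _ _ _ vm vm'.
  apply/eqP/rowP => x; rewrite mxE.
  have: x \in [:: i; j; k; l; m; n].
    (* Six distinct indices exhaust ['I_6]. *)
    suff ->: [:: i; j; k; l; m; n] =i 'I_6 by [].
    apply/subset_cardP; last exact: subset_predT.
    by rewrite (card_uniqP uI) card_ord.
  by rewrite !inE; do 5?[case/predU1P => [->|] //]; move/eqP=> ->.
rewrite -(leq_add2r 3) (@leq_trans (\dim (plane K i s j k t l m u n) +
  \dim (plane K i (~~ s) j k (~~ t) l m (~~ u) n))) ?leq_add2l ?dim_plane_ge3 //.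
rewrite -dimv_sum_cap cap0 dimv0 addn0 (leq_trans (dimvS (subvf _))) //.
by rewrite dimvf /dim /= mul1n.
Qed.

Lemma matchings_uniq :
  all (fun M => uniq [:: M.1.1.1; M.1.1.2; M.1.2.1; M.1.2.2; M.2.1; M.2.2])
    matchings.
Proof. by []. Qed.

Lemma dim_twenty_planes : {in twenty_planes K, forall U, \dim U = 3%N}.
Proof.
move=> U; rewrite twenty_planes_flatten => /flatten_mapP[M sM].
have /allP/(_ M sM) uM := matchings_uniq.
by rewrite !inE; do 3?[case/predU1P => [->|]]; last move/eqP ->; rewrite dim_plane.
Qed.

End Solutions.

(** * The span of the twenty lines and its isotropy *)

Section Span.
Variable K : numFieldType.

Definition span_planes : {vspace extalg K 6} :=
  (\sum_(U <- twenty_planes K) extpow 3 U)%VS.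

(** Closure under sums suffices, because each [extpow 3 U] is already closed under scalars. *)
Lemma mem_span_planes_ind (P : extalg K 6 -> Prop) :
    P 0 -> (forall x y, P x -> P y -> P (x + y)) ->
    (forall U x, U \in twenty_planes K -> x \in extpow 3 U -> P x) ->
  forall x, x \in span_planes -> P x.
Proof.
move=> P0 PD; rewrite /span_planes; elim: (twenty_planes K) => [|U s IHs] PU x.
  by rewrite big_nil memv0 => /eqP ->.
rewrite big_cons => /memv_addP[y yU [z zs ->]]; apply: PD.
  by apply: PU yU; rewrite mem_head.
by apply: IHs zs => V y' sV; apply: PU; rewrite inE sV orbT.
Qed.

Lemma extpow_span_planes U : U \in twenty_planes K ->
  (extpow 3 U <= span_planes)%VS.
Proof.
rewrite /span_planes; elim: (twenty_planes K) => // V s IHs.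
rewrite inE big_cons => /predU1P[->|/IHs sU]; first exact: addvSl.
exact: subv_trans sU (addvSr _ _).
Qed.

(** Grassmann's formula: the common line leaves at most 3 + 3 - 1 dimensions for the sum. *)
Lemma dim_addv_incident (U W : {vspace 'rV[K]_6}) :
  \dim U = 3%N -> \dim W = 3%N -> incident U W -> (\dim (U + W) < 6)%N.
Proof.
move=> dU dW [p [dp pU pW]].
rewrite -(ltn_add2r (\dim (U :&: W))) dimv_sum_cap dU dW -addn1 leq_add2l.
apply: (@leq_trans (\dim p)); first by rewrite dp.
by rewrite dimvS // subv_cap pU.
Qed.

Lemma span_planes_mul0 : {in span_planes &, forall x y, x * y = 0}.
Proof.
move=> x y xA yA; elim/mem_span_planes_ind: x / xA => [|x x' x0 x'0|U x sU xU].
- by rewrite mul0r.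
- by rewrite mulrDl x0 x'0 addr0.
elim/mem_span_planes_ind: y / yA => [|y y' y0 y'0|W y sW yW].
- by rewrite mulr0.
- by rewrite mulrDr y0 y'0 addr0.
apply: extpowM_eq0 xU yW; apply: dim_addv_incident; last exact: twenty_planes_incident.
  exact: dim_twenty_planes.
exact: dim_twenty_planes.
Qed.

(** * Trivectors of the planes and transversals of the matchings *)

Definition signed_vector (i : 'I_6) (s : bool) (j : 'I_6) : 'rV[K]_6 :=
  delta_mx 0 j - (-1) ^+ s *: delta_mx 0 i.

Lemma signed_vectorE i s j a :
  signed_vector i s j 0 a = (a == j)%:R - (-1) ^+ s * (a == i)%:R.
Proof. by rewrite !mxE !eqxx. Qed.

(** Each vector solves the equation of its own pair and has zero coordinates on the other two
    pairs. *)
Lemma mem_plane_signed_vectors i s j k t l m u n :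
    uniq [:: i; j; k; l; m; n] ->
  [/\ signed_vector i s j \in plane K i s j k t l m u n,
      signed_vector k t l \in plane K i s j k t l m u n &
      signed_vector m u n \in plane K i s j k t l m u n].
Proof.
rewrite /= !inE !negb_or -!andbA.
case/and5P=> ij ik il im /and5P[ein jk jl jm /and5P[jn kl km kn /and4P[lm ln mn _]]].
have ne (a b : 'I_6) : a != b -> ((a == b) = false) * ((b == a) = false).
  by move=> /negPf ab; rewrite [b == a]eq_sym ab.
rewrite !memv_cap !mem_hyperplane !signed_vectorE !eqxx.
rewrite !(ne _ _ ij, ne _ _ ik, ne _ _ il, ne _ _ im, ne _ _ ein).
rewrite !(ne _ _ jk, ne _ _ jl, ne _ _ jm, ne _ _ jn, ne _ _ kl, ne _ _ km).
rewrite !(ne _ _ kn, ne _ _ lm, ne _ _ ln, ne _ _ mn).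
by rewrite !(mulr0, mulr1, subr0, sub0r, addr0, addNr, eqxx).
Qed.

(** The four sign triples have product 1. A monomial with one primed factor sums a single sign over
    them; with two, the product of two signs is the third. Both sums are 0, so only the unmixed
    monomials remain, each four times. *)
Lemma mulr_polarization (R : nzRingType) (a a' b b' c c' : R) :
  (a + a') * (b + b') * (c + c') + (a + a') * (b - b') * (c - c') +
  ((a - a') * (b + b') * (c - c') + (a - a') * (b - b') * (c + c')) =
    (a * b * c + a' * b' * c') *+ 4.
Proof.
have split2 (x x' y y' : R) :
    (x + x') * y + (x - x') * y' = x * (y + y') + x' * (y - y').
  by rewrite mulrDl mulrBl addrACA -mulrDr -mulrBr.
have addp (x y : R) : (x + y) + (x - y) = x *+ 2.
  by rewrite addrACA subrr addr0 mulr2n.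
have subp (x y : R) : (x + y) - (x - y) = y *+ 2.
  by rewrite opprB [y - x]addrC addrACA subrr add0r mulr2n.
rewrite -!mulrA -!mulrDr !split2 addp subp [c - c' + _]addrC addp.
rewrite -[c - c' - _]opprB subp mulrN addp subp -!mulrnAr.
by rewrite !mulrnAr -!mulrnA mulrnDl.
Qed.

Lemma card_set3 (T : finType) (a b c : T) :
  uniq [:: a; b; c] -> #|[set a; b; c]| = 3%N.
Proof.
by move=> /card_uniqP/= <-; apply: eq_card => x; rewrite !inE orbA.
Qed.

Lemma set3_compl (a b c a' b' c' : 'I_6) :
    uniq [:: a; b; c] -> uniq [:: a'; b'; c'] ->
    ~~ has [in [:: a; b; c]] [:: a'; b'; c'] ->
  ~: [set a'; b'; c'] = [set a; b; c].
Proof.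
move=> u u' /hasPn dis; apply/esym/eqP; rewrite eqEcard card_set3 //.
rewrite cardsCs setCK card_ord card_set3 // andbT.
apply/subsetP => x xabc; rewrite inE; apply: contraL (xabc) => xabc'.
by have := dis x; rewrite !inE orbA in xabc' *; rewrite !orbA => ->.
Qed.

Lemma odd_signs_transversal (A : {vspace extalg K 6}) i j k l m n :
    uniq [:: i; j; k; l; m; n] ->
    {in odd_signs K i j k l m n, forall U, extpow 3 U <= A}%VS ->
  exists c : K, ebasis K [set j; l; n] + c *: ebasis K (~: [set j; l; n]) \in A.
Proof.
move=> uI sA; pose e a : extalg K 6 := ext_gen (delta_mx 0 a).
have gA s t u : plane K i s j k t l m u n \in odd_signs K i j k l m n ->
    (e j - (-1) ^+ s *: e i) * (e l - (-1) ^+ t *: e k) *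
      (e n - (-1) ^+ u *: e m) \in A.
  move=> /sA/subvP sUA; apply: sUA; rewrite /e -!linearZ -!linearB.
  by have [? ? ?] := mem_plane_signed_vectors s t u uI; apply: mem_extpow3.
have eA : e j * e l * e n + e i * e k * e m \in A.
  (* The position in the list fixes the signs by unification: positions 0, 1, 2 have one minus sign,
     position 3 has three. *)
  have odd_mem a : (a < 4)%N ->
    nth 0%VS (odd_signs K i j k l m n) a \in odd_signs K i j k l m n.
    by move=> lta4; apply: (@mem_nth _ _ (odd_signs K i j k l m n)).
  have := gA _ _ _ (odd_mem 3%N isT); have := gA _ _ _ (odd_mem 0%N isT).
  have := gA _ _ _ (odd_mem 1%N isT); have := gA _ _ _ (odd_mem 2%N isT).
  rewrite expr0 expr1 !scaleN1r !scale1r !opprK => g3 g2 g1 g4.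
  have: (e j * e l * e n + e i * e k * e m) *+ 4 \in A.
    by rewrite -mulr_polarization !memvD.
  (* Division by 4 is possible in characteristic zero. *)
  by rewrite -scaler_nat rpredZeq pnatr_eq0.
have : perm_eq [:: i; j; k; l; m; n] ([:: i; k; m] ++ [:: j; l; n]).
  (* A permutation of lists amounts to equal counts for every predicate, an identity of sums that
     [ring] proves. *)
  by apply/seq.permP => p /=; ring.
move/perm_uniq; rewrite uI cat_uniq => /esym/and3P[uikm dis ujln].
have [s Ds] := ext_gen_mul3 K ujln; have [t Dt] := ext_gen_mul3 K uikm.
(* The sign s normalises the coefficient of e_S to 1 and moves to that of the complement. *)
rewrite (set3_compl uikm ujln) //; exists ((-1) ^+ s * (-1) ^+ t).
rewrite -(rpredZsign _ s) scalerDr scalerA mulrA -expr2 sqrr_sign mul1r.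
by rewrite -Ds -Dt.
Qed.

Definition transversal_in (S : {set 'I_6}) : Prop :=
  exists c : K, ebasis K S + c *: ebasis K (~: S) \in span_planes.

Lemma hyperplaneC i s j : hyperplane K i s j = hyperplane K j s i.
Proof.
apply/vspaceP => v; rewrite !mem_hyperplane -[v 0 i](signrMK s) -mulrDr.
by rewrite mulf_eq0 signr_eq0 signrMK addrC.
Qed.

(** Exchanging the indices of a pair preserves each hyperplane, sign included. The chosen element of
    every pair can thus be put in second place, as [odd_signs_transversal] expects. *)
Lemma matching_transversal M j l n : M \in matchings ->
    j \in [:: M.1.1.1; M.1.1.2] -> l \in [:: M.1.2.1; M.1.2.2] ->
    n \in [:: M.2.1; M.2.2] ->
  transversal_in [set j; l; n].
Proof.
move=> sM jM lM nM; pose Q i j k l m n := uniq [:: i; j; k; l; m; n] /\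
  {in odd_signs K i j k l m n, forall U, extpow 3 U <= span_planes}%VS.
have Qswap1 i0 j0 k0 l0 m0 n0 : Q i0 j0 k0 l0 m0 n0 -> Q j0 i0 k0 l0 m0 n0.
  case=> uI sA; split; last first.
    by move: sA; rewrite /odd_signs /plane ![hyperplane K i0 _ _]hyperplaneC.
  by rewrite (perm_uniq (_ : perm_eq _ [:: i0; j0; k0; l0; m0; n0])) //;
    apply/seq.permP => p /=; ring.
have Qswap2 i0 j0 k0 l0 m0 n0 : Q i0 j0 k0 l0 m0 n0 -> Q i0 j0 l0 k0 m0 n0.
  case=> uI sA; split; last first.
    by move: sA; rewrite /odd_signs /plane ![hyperplane K k0 _ _]hyperplaneC.
  by rewrite (perm_uniq (_ : perm_eq _ [:: i0; j0; k0; l0; m0; n0])) //;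
    apply/seq.permP => p /=; ring.
have Qswap3 i0 j0 k0 l0 m0 n0 : Q i0 j0 k0 l0 m0 n0 -> Q i0 j0 k0 l0 n0 m0.
  case=> uI sA; split; last first.
    by move: sA; rewrite /odd_signs /plane ![hyperplane K m0 _ _]hyperplaneC.
  by rewrite (perm_uniq (_ : perm_eq _ [:: i0; j0; k0; l0; m0; n0])) //;
    apply/seq.permP => p /=; ring.
have QM : Q M.1.1.1 M.1.1.2 M.1.2.1 M.1.2.2 M.2.1 M.2.2.
  split; first exact: (allP matchings_uniq).
  move=> U sU; apply: extpow_span_planes; rewrite twenty_planes_flatten.
  by apply/flatten_mapP; exists M.
have [i Qi] : exists i, Q i j M.1.2.1 M.1.2.2 M.2.1 M.2.2.
  move: jM; rewrite !inE => /orP[]/eqP->; last by exists M.1.1.1.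
  by exists M.1.1.2; apply: Qswap1.
have [k Qk] : exists k, Q i j k l M.2.1 M.2.2.
  move: lM; rewrite !inE => /orP[]/eqP->; last by exists M.1.2.1.
  by exists M.1.2.2; apply: Qswap2.
have [m [uI sA]] : exists m, Q i j k l m n.
  move: nM; rewrite !inE => /orP[]/eqP->; last by exists M.2.1.
  by exists M.2.2; apply: Qswap3.
exact: odd_signs_transversal uI sA.
Qed.

(** The five matchings partition the 15 pairs of indices. The three pairs inside a triple {0, b, c}
    intersect one another, hence lie in three different matchings; the triple is transversal to the
    other two. *)
Lemma matchings_transversals :
  all (fun b => all (fun c => (b == c) || has (fun M => (M.1.1.1 == 0) &&
      ((b \in [:: M.1.2.1; M.1.2.2]) && (c \in [:: M.2.1; M.2.2]) ||
       (c \in [:: M.1.2.1; M.1.2.2]) && (b \in [:: M.2.1; M.2.2])))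
    matchings) [:: 1; 2; 3; 4; 5]) [:: 1; 2; 3; 4; 5].
Proof. by lazy. Qed.

Lemma triple_transversal (S : {set 'I_6}) :
  0 \in S -> #|S| = 3%N -> transversal_in S.
Proof.
move=> S0; rewrite (cardsD1 0) S0 add1n => /succn_inj/eqP/cards2P[b [c [nbc DS]]].
have nonzero x : x \in [set b; c] -> x \in ([:: 1; 2; 3; 4; 5] : seq 'I_6).
  by rewrite -DS !inE => /andP[+ _]; case: x => [[|[|[|[|[|[|//]]]]]] ?].
have /allP/(_ b (nonzero b (set21 b c)))
  /allP/(_ c (nonzero c (set22 b c))) := matchings_transversals.
have DSbc : S = [set 0; b; c] by rewrite -(setD1K S0) DS setUA.
have DScb : S = [set 0; c; b] by rewrite -(setD1K S0) DS setUA setUAC.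
(* The matching lists the pairs of b and c in either order, whence the two ways of writing S. *)
rewrite (negPf nbc) => /hasP[M sM /andP[/eqP M0 /orP[]/andP[bM cM]]].
  by rewrite DSbc; apply: (matching_transversal sM _ bM cM); rewrite M0 mem_head.
by rewrite DScb; apply: (matching_transversal sM _ bM cM); rewrite M0 mem_head.
Qed.

Lemma span_planes_lagrangian :
  lagrangian (@wedge_form K 6) (extpow 3 fullv) span_planes.
Proof.
apply: (@lagrangian_of_halves _ _ 3 0) => //; last exact: triple_transversal.
  apply/subvP => x; elim/mem_span_planes_ind => [|y z yE zE|U y _].
  - exact: mem0v.
  - exact: memvD.
  exact: (subvP (extpowS 3 (subvf U))).
by move=> x y xA yA; rewrite /wedge_form (span_planes_mul0 xA yA) ffunE.
Qed.

End Span.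

(* R[i] is the field of complex numbers. *)
Theorem proposition2p5 (R : realType) :
  let planes := twenty_planes R[i] in
  [/\ forall U : {vspace 'rV[R[i]]_6},
        U \in planes <->
        coord_orbit betaS5 (plane R[i] 0 true 1 2 true 3 4 true 5) U \/
        coord_orbit betaS5 (plane R[i] 0 false 1 2 false 3 4 true 5) U,
      uniq planes /\ size planes = 20%N,
      {in planes, forall U, \dim U = 3%N},
      {in planes &, forall U W, incident U W} &
      lagrangian (@wedge_form R[i] 6) (extpow 3 fullv)
        (\sum_(U <- planes) extpow 3 U)%VS].
Proof.
split.
- exact: twenty_planes_orbits.
- by split; first exact: twenty_planes_uniq.
- exact: dim_twenty_planes.
- exact: twenty_planes_incident.
exact: span_planes_lagrangian.
Qed.
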